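(* Let $X$ be a regular ($T_1$) space. If $X$ is infinite, then $$X \text{ is separable} \iff \mathrm{I} \underset{\mathrm{pre}}{\uparrow} \mathsf G_1(\mathscr N_X[[X]^{<\omega}] , \neg \mathrm{DO}_X) \iff \mathrm{II} \underset{\mathrm{mark}}{\uparrow} \mathsf G_1(\Omega_X , \mathrm{DO}_X),$$ and if $X$ is non-compact, then $$wkc(K(X)) \leq \omega \iff \mathrm{I} \underset{\mathrm{pre}}{\uparrow} \mathsf G_1(\mathscr N_X[K(X)] , \neg \mathrm{DO}_X) \iff \mathrm{II} \underset{\mathrm{mark}}{\uparrow} \mathsf G_1(\mathcal K_X , \mathrm{DO}_X).$$ If $X$ is, in addition, metrizable, then (for $X$ infinite) $$\begin{aligned}X \text{ is separable} &\iff \mathrm{I} \underset{\mathrm{pre}}{\uparrow} \mathsf G_1(\mathscr N_X[[X]^{<\omega}] , \neg \mathrm{DO}_X) \iff \mathrm{I} \uparrow \mathsf G_1(\mathscr N_X[[X]^{<\omega}] , \neg \mathrm{DO}_X)\\ &\iff \mathrm{II} \underset{\mathrm{mark}}{\uparrow} \mathsf G_1(\Omega_X , \mathrm{DO}_X) \iff \mathrm{II} \uparrow \mathsf G_1(\Omega_X , \mathrm{DO}_X)\end{aligned}$$ and (for $X$ non-compact) $$\begin{aligned}wkc(K(X)) \leq \omega &\iff \mathrm{I} \underset{\mathrm{pre}}{\uparrow} \mathsf G_1(\mathscr N_X[K(X)] , \neg \mathrm{DO}_X) \iff \mathrm{I} \uparrow \mathsf G_1(\mathscr N_X[K(X)]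 , \neg \mathrm{DO}_X)\\ &\iff \mathrm{II} \underset{\mathrm{mark}}{\uparrow} \mathsf G_1(\mathcal K_X , \mathrm{DO}_X) \iff \mathrm{II} \uparrow \mathsf G_1(\mathcal K_X , \mathrm{DO}_X).\end{aligned}$$
   Context: Games. For collections $\mathcal P,\mathcal Q$ of sets, in the game $\mathsf G_1(\mathcal P,\mathcal Q)$, at round $n\in\omega$ One chooses $P_n\in\mathcal P$ and Two responds with $x_n\in P_n$; Two wins if $\{x_n:n\in\omega\}\in\mathcal Q$, otherwise One wins. $\neg\mathcal Q$ denotes the collection of sets not in $\mathcal Q$. A strategy for One is $\sigma:(\bigcup\mathcal P)^{<\omega}\to\mathcal P$; it is winning if $\{x_n:n\in\omega\}\notin\mathcal Q$ whenever $x_n\in\sigma\langle x_k:k<n\rangle$ for all $n$; $\mathrm I\uparrow$ means One has a winning strategy. A strategy for Two is $\tau:\mathcal P^{<\omega}\to\bigcup\mathcal P$ (giving legal moves); it is winning if $\{\tau(P_0,\dots,P_n):n\in\omega\}\in\mathcal Q$ for all $(P_n)\in\mathcal P^\omega$; $\mathrm{II}\uparrow$ means Two has a winning strategy. A predetermined strategy for One is a function $\omega\to\mathcal P$ (depends only on the round); $\mathrm I\underset{\mathrm{pre}}{\uparrow}$ means One has a winning one. A Markov strategy for Two is a function $\mathcal P\times\omega\to\bigcup\mathcal P$ (depends only on One's latest move and the round); $\mathrm{II}\underset{\mathrm{mark}}{\uparrow}$ means Two has a winning one. Classes. $K(X)$ is the set of non-empty compact subsets of $X$; $[X]^{<\omega}$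 is the set of (non-empty) finite subsets of $X$. $\Omega_X$ (resp. $\mathcal K_X$) is the set of open covers $\mathscr U$ of $X$ with $\emptyset,X\notin\mathscr U$ such that each non-empty finite (resp. compact) subset of $X$ is contained in some $U\in\mathscr U$. $\mathscr T_X$ is the family of proper non-empty open subsets of $X$; $\mathscr N_X(A)=\{U\in\mathscr T_X:A\subseteq U\}$; $\mathscr N_X[\mathcal A]=\{\mathscr N_X(A):A\in\mathcal A\}$. $\mathrm{DO}_X$ is the set of all $\mathscr U\subseteq\mathscr T_X$ with $X=\mathrm{cl}(\bigcup\mathscr U)$. For a collection $\mathcal A$ of closed subsets of $X$, the weak covering number $wkc(\mathcal A)$ is the least cardinal $\kappa$ for which there is $\mathscr F\subseteq\mathcal A$ of cardinality $\kappa$ with $X=\mathrm{cl}(\bigcup\mathscr F)$. *)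

(* Defs.v *)
From mathcomp Require Import all_boot all_order all_algebra.
From mathcomp Require Import all_classical reals topology.

Set Implicit Arguments.
Unset Strict Implicit.
Unset Printing Implicit Defensive.

Import Order.TTheory GRing.Theory Num.Theory.

Local Open Scope classical_set_scope.
Local Open Scope ring_scope.
Local Open Scope card_scope.

(** Selection games [G_1(P, Q)] on a set [M] of possible moves of Two.  Strategies
    are total functions on [M]-valued data; legality is only required on the
    histories that the intended domain consists of. *)
Section Games.
Context {M : Type}.
Implicit Types P Q : set (set M).

Definition legal_strategy_I P (sigma : seq M -> set M) :=
  forall s, all (fun x => x \in \bigcup_(A in P) A) s -> P (sigma s).

Definition winning_strategy_I Q (sigma : seq M -> set M) :=
  forall x : nat -> M, (forall n, sigma (mkseq x n) (x n)) -> ~ Q (range x).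

Definition I_wins P Q :=
  exists2 sigma, legal_strategy_I P sigma & winning_strategy_I Q sigma.

(* The last entry of the history is the move of One being answered; the value
   at the empty history is irrelevant. *)
Definition legal_strategy_II P (tau : seq (set M) -> M) :=
  forall s A, all (fun B => B \in P) s -> P A -> A (tau (rcons s A)).

Definition winning_strategy_II P Q (tau : seq (set M) -> M) :=
  forall A : nat -> set M, (forall n, P (A n)) ->
    Q (range (fun n => tau (mkseq A n.+1))).

Definition II_wins P Q :=
  exists2 tau, legal_strategy_II P tau & winning_strategy_II P Q tau.

Definition legal_predetermined_I P (sigma : nat -> set M) :=
  forall n, P (sigma n).

Definition winning_predetermined_I Q (sigma : nat -> set M) :=
  forall x : nat -> M, (forall n, sigma n (x n)) -> ~ Q (range x).

Definition I_pre_wins P Q :=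
  exists2 sigma, legal_predetermined_I P sigma & winning_predetermined_I Q sigma.

Definition legal_markov_II P (tau : set M -> nat -> M) :=
  forall A n, P A -> A (tau A n).

Definition winning_markov_II P Q (tau : set M -> nat -> M) :=
  forall A : nat -> set M, (forall n, P (A n)) ->
    Q (range (fun n => tau (A n) n)).

Definition II_mark_wins P Q :=
  exists2 tau, legal_markov_II P tau & winning_markov_II P Q tau.

End Games.

Section Classes.
Context (X : topologicalType).
Implicit Types (A : set X) (FF UU : set (set X)).

Definition nonempty_compacts : set (set X) :=
  [set K | compact K /\ K !=set0].

Definition nonempty_finites : set (set X) :=
  [set F | finite_set F /\ F !=set0].

Definition proper_opens : set (set X) :=
  [set U | [/\ open U, U !=set0 & U != setT]].

Definition open_nbhd_family A : set (set X) :=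
  [set U | proper_opens U /\ A `<=` U].

Definition open_nbhd_families FF : set (set (set X)) :=
  open_nbhd_family @` FF.

Definition open_covers_of FF : set (set (set X)) :=
  [set UU | [/\ UU `<=` open, \bigcup_(U in UU) U = setT,
              ~ UU set0, ~ UU setT &
              forall A, FF A -> exists2 U, UU U & A `<=` U]].

Definition omega_covers := open_covers_of nonempty_finites.

Definition k_covers := open_covers_of nonempty_compacts.

Definition dense_open_families : set (set (set X)) :=
  [set UU | UU `<=` proper_opens /\ closure (\bigcup_(U in UU) U) = setT].

Definition separable := exists2 D : set X, countable D & dense D.

Definition weak_covering FF UU :=
  UU `<=` FF /\ closure (\bigcup_(U in UU) U) = setT.

(* A cardinal is represented by any set of that cardinality: [C] represents
   the weak covering number of [FF]. *)
Definition is_wkc FF (T : Type) (C : set T) :=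
  (exists2 UU, weak_covering FF UU & UU #= C) /\
  (forall UU, weak_covering FF UU -> C #<= UU).

(* It is enough to let the representative range over sets of subsets of [X],
   since the least cardinal is attained by a subfamily of [FF]. *)
Definition wkc_le FF (T : Type) (C : set T) :=
  exists2 W : set (set X), is_wkc FF W & W #<= C.

Definition metrizable (R : realType) := exists d : X -> X -> R,
  [/\ forall x, d x x = 0,
      forall x y, d x y = 0 -> x = y,
      forall x y, d x y = d y x,
      forall y x z, d x z <= d x y + d y z &
      forall x, nbhs x =
        filter_from [set e : R | 0 < e] (fun e => [set y | d x y < e])].

End Classes.

Arguments nonempty_compacts X : clear implicits.
Arguments nonempty_finites X : clear implicits.
Arguments proper_opens X : clear implicits.
Arguments omega_covers X : clear implicits.
Arguments k_covers X : clear implicits.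
Arguments dense_open_families X : clear implicits.

(* Main.v *)
Require Import Defs.
From mathcomp Require Import all_boot all_order all_algebra.
From mathcomp Require Import all_classical interval_inference reals topology num_normedtype.

(** Let FF be the family of non-empty finite or of non-empty compact subsets of
a non-empty space X.  All the conditions of the theorem amount to one property of FF: some
sequence (A_n) in FF has a dense union ([countably_densely_covered]).  For
finite sets this is separability ([separableP]), and for compact sets it says
that the weak covering number is at most countable ([wkc_le_natP]).

A predetermined strategy of One in the neighborhood game is a sequence (A_n) in
FF, and Two answers with proper open sets U_n containing A_n.  If the union of
the A_n is dense, so is that of the U_n.  If it is not, regularity gives a
non-empty open V whose closure misses every A_n, and Two wins by always
answering with the complement of that closure ([open_nbhds_dense],
[I_pre_wins_open_nbhdP]).

The game of Two on covers is dual to it.  A sequence (A_n) tells Two to pick, at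
round n, a member of the cover that contains A_n.  Conversely, a function f
that selects a member of every FF-cover must reach all the proper open
neighborhoods of some A in FF: otherwise each A has a neighborhood that f
misses, these neighborhoods form an FF-cover, and f selects one of them
([selector_covers_nbhds]).  Applied to the rounds of a Markov strategy, this
yields a predetermined strategy of One; applied along the histories of an
arbitrary strategy of Two, it yields a strategy of One ([II_wins_I_wins]).

In a metrizable space it remains to extract a sequence (A_n) from an arbitrary
winning strategy of One.  Every compact A has a countable base of open
neighborhoods, namely the 1/(k+1)-neighborhoods of A
([metrizable_compact_outer_base]).  Letting Two play only such basic
neighborhoods gives a countable tree of positions.  If the sets that One plays
at these positions did not have a dense union, their union would miss the
closure of a non-empty open V, and Two could follow a branch of the tree made
of neighborhoods disjoint from that closure, and beat the strategy
([I_wins_countably_densely_covered]). *)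

Local Open Scope card_scope.
Local Open Scope classical_set_scope.

(** * Dense unions of countable families *)

Lemma countable_range {T : Type} {A : set T} :
  countable A -> A !=set0 -> exists f : nat -> T, range f = A.
Proof.
move=> /pfcard_geP[->|[f] _]; first by case.
by exists f; exact: image_eq.
Qed.

Lemma dense_closureP {X : topologicalType} (S : set X) :
  dense S <-> closure S = setT.
Proof.
split=> [dS|cS O [x Ox] oO].
  rewrite -subTset => x _ B; rewrite nbhsE => -[O [oO Ox] OB].
  have [y [Oy Sy]] := dS O (ex_intro _ x Ox) oO.
  by exists y; split=> //; exact: OB.
have : closure S x by rewrite cS.
by move=> /(_ O (open_nbhs_nbhs (conj oO Ox)))[y [Sy Oy]]; exists y.
Qed.

Lemma regular_not_dense {X : topologicalType} {S : set X} :
  regular_space X -> ~ dense S ->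
  exists V, [/\ open V, V !=set0 & S `<=` ~` closure V].
Proof.
move=> regX /denseNE[O [[x [oO Ox]] OS]].
have [B xB clBO] := regX x O (open_nbhs_nbhs (conj oO Ox)).
exists B^°; split; [exact: open_interior| by exists x; exact: xB|].
move=> y Sy cy; rewrite -[False]/(set0 y) -OS; split=> //.
by apply: clBO; apply: closure_subset cy; exact: interior_subset.
Qed.

Definition countably_densely_covered {X : topologicalType} (FF : set (set X)) :=
  exists2 A : nat -> set X, (forall n, FF (A n)) & dense (\bigcup_n A n).

Lemma separableP {X : topologicalType} : [set: X] !=set0 ->
  separable X <-> countably_densely_covered (nonempty_finites X).
Proof.
move=> X0; split=> [[D cD dD]|[A fA dA]]; last first.
  exists (\bigcup_n A n) => //; apply: bigcup_countable => // n _.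
  by apply: finite_set_countable; case: (fA n).
have [x [_ Dx]] := dD _ X0 openT.
have [f fD] := countable_range cD (ex_intro _ x Dx).
exists (fun n => [set f n]).
  by move=> n; split; [exact: finite_set1|exists (f n)].
by rewrite bigcup_imset1 fD.
Qed.

(** The weak covering number is a least cardinal, so the right-to-left
implication has to exhibit a weak covering of least cardinality: a finite one
with the fewest members if there is a finite one, and otherwise any countable
one, since every weak covering is then infinite. *)
Lemma wkc_le_natP {X : topologicalType} (FF : set (set X)) : [set: X] !=set0 ->
  wkc_le FF [set: nat] <-> countably_densely_covered FF.
Proof.
move=> X0; split=> [[W [[UU [UUF cUU] UUW] _] cW]|[A FA dA]].
  have cntUU : countable UU by rewrite (eq_countable UUW).
  have [U0 UU0] : UU !=set0.
    have [x [_ [U UUU _]]] := proj2 (dense_closureP _) cUU _ X0 openT.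
    by exists U.
  have [A UUA] := countable_range cntUU (ex_intro _ U0 UU0).
  exists A; first by move=> n; apply: UUF; rewrite -UUA; exists n.
  by apply/dense_closureP; rewrite -[RHS]cUU -UUA bigcup_image.
have wA : weak_covering FF (range A).
  by split; [move=> _ [n _ <-]|rewrite bigcup_image; exact/dense_closureP].
have cA : countable (range A) by exact: card_image_le.
have [[UU wUU fUU]|nfin] :=
  pselect (exists2 UU, weak_covering FF UU & finite_set UU); last first.
  exists (range A) => //; split; first by exists (range A).
  move=> VV wVV; apply: card_le_trans cA _; apply/infiniteP => fVV.
  by apply: nfin; exists VV.
pose P n := `[< exists2 VV, weak_covering FF VV & VV #= `I_n >].
have exP : exists n, P n.
  by have [n UUn] := fUU; exists n; apply/asboolP; exists UU.
have [n /asboolP[VV wVV VVn] nmin] := ex_minnP exP.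
exists VV; last first.
  by apply: finite_set_countable; exists n.
split=> [|V wV]; first by exists VV.
rewrite (card_le_eql VVn).
have [[m Vm]|/infiniteP iV] := pselect (finite_set V).
  rewrite (card_le_eqr Vm) card_le_II; apply: nmin.
  by apply/asboolP; exists V.
by apply: card_le_trans iV; exact: subset_card_le.
Qed.

(** * From weak strategies to strategies with perfect information *)

Lemma I_pre_wins_I_wins {M : Type} (P Q : set (set M)) :
  I_pre_wins P Q -> I_wins P Q.
Proof.
move=> [sigma sigmaP win]; exists (fun s => sigma (size s)).
  by move=> s _; exact: sigmaP.
by move=> x xP; apply: win => n; have := xP n; rewrite size_mkseq.
Qed.

Lemma II_mark_wins_II_wins {M : Type} (P Q : set (set M)) :
  II_mark_wins P Q -> II_wins P Q.
Proof.
move=> [tau tauP win].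
exists (fun s => tau (last set0 s) (size s).-1).
  by move=> s A _ PA; rewrite last_rcons size_rcons; exact: tauP.
move=> A PA; rewrite [X in range X](_ : _ = fun n => tau (A n) n).
  exact: win.
by apply/funext => n; rewrite mkseqS last_rcons size_rcons size_mkseq.
Qed.

(** * The dual games played with a family of sets *)

Definition countable_outer_base {X : topologicalType} (A : set X) :=
  exists2 b : nat -> set X, forall k, open (b k) /\ A `<=` b k &
    forall O, open O -> A `<=` O -> exists k, b k `<=` O.

Section GamesOnCoverings.
Context {X : topologicalType} (FF : set (set X)).
Hypothesis FF_neq0 : forall A, FF A -> A !=set0.
Hypothesis FF_points : forall x, FF [set x].
Hypothesis X_regular : regular_space X.

(** The left-hand side does not mention the answers U because, in a regular
space, the worst of them is constant: the complement of the closure of an open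
set that certifies that the union of the A_n is not dense. *)
Lemma open_nbhds_dense (A : nat -> set X) : (forall n, FF (A n)) ->
  dense (\bigcup_n A n) <->
  forall U : nat -> set X, (forall n, open_nbhd_family (A n) (U n)) ->
    dense_open_families X (range U).
Proof.
move=> FA; split=> [dA U AU|allU].
  split=> [_ [n _ <-]|]; first by case: (AU n).
  apply/dense_closureP; rewrite bigcup_image => O O0 oO.
  have [x [Ox [n _ Ax]]] := dA O O0 oO.
  by exists x; split=> //; exists n => //; case: (AU n) => _; exact.
apply: contrapT => /(regular_not_dense X_regular)[V [oV V0 AV]].
have ocV : open (~` closure V) by rewrite openC; exact: closed_closure.
have : dense_open_families X (range (fun _ : nat => ~` closure V)).
  apply: allU => n; split; last by move=> x Ax; apply: AV; exists n.
  split=> //.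
    by have [x Ax] := FF_neq0 _ (FA n); exists x; apply: AV; exists n.
  apply/eqP => cVT; have [x Vx] := V0.
  have : (~` closure V) x by rewrite cVT.
  by apply; exact: subset_closure.
case=> _ /dense_closureP/(_ V V0 oV)[x [Vx [_ [n _ <-] ncVx]]].
by apply: ncVx; exact: subset_closure.
Qed.

Lemma I_pre_wins_open_nbhdP :
  I_pre_wins (open_nbhd_families FF) (~` dense_open_families X) <->
  countably_densely_covered FF.
Proof.
split=> [[sigma sigmaP win]|[A FA dA]].
  have /choice[A AP] : forall n, exists A,
      FF A /\ open_nbhd_family A = sigma n.
    by move=> n; have [A FA <-] := sigmaP n; exists A.
  have FA n : FF (A n) by case: (AP n).
  exists A => //; apply/(open_nbhds_dense _ FA) => U AU.
  by apply: contrapT; apply: win => n; case: (AP n) => _ <-.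
exists (fun n => open_nbhd_family (A n)); first by move=> n; exists (A n).
by move=> U AU; apply; exact: (proj1 (open_nbhds_dense _ FA)).
Qed.

(** The hinge of the duality.  If every A in FF had a proper open neighborhood
g A that is not a value of f, then these sets g A would form a cover of which f
cannot select a member. *)
Lemma selector_covers_nbhds (f : set (set X) -> set X) :
  (forall UU, open_covers_of FF UU -> UU (f UU)) ->
  exists2 A, FF A & forall U, open_nbhd_family A U ->
    exists2 UU, open_covers_of FF UU & f UU = U.
Proof.
move=> fP; apply: contrapT => noA.
have /choice[g gP] : forall A, exists U, FF A ->
    open_nbhd_family A U /\ forall UU, open_covers_of FF UU -> f UU <> U.
  move=> A; apply: contrapT => /forallNP noU; apply: noA; exists A.
    (* outside FF the requirement on U is vacuous, so any set would do *)
    by apply: contrapT => nFA; apply: (noU setT) => /nFA.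
  move=> U AU; apply: contrapT => noUU; apply: (noU U) => FA; split=> //.
  by move=> UU oUU fUU; apply: noUU; exists UU.
have cov : open_covers_of FF (g @` FF).
  split.
  - by move=> _ [A /gP[[[oU _ _] _] _] <-].
  - rewrite -subTset => x _; exists (g [set x]); first by exists [set x].
    by have [[_ /(_ x erefl)]] := gP _ (FF_points x).
  - by move=> [A /gP[[[_ [x gx] _] _] _] gA]; rewrite gA in gx.
  - by move=> [A /gP[[[_ _ /eqP gNT] _] _]].
  - by move=> A FA; exists (g A); [exists A|case: (gP _ FA) => -[]].
have [A FA gA] := fP _ cov.
by have [_ /(_ _ cov)] := gP _ FA; rewrite gA.
Qed.

Lemma I_pre_wins_II_mark_wins :
  I_pre_wins (open_nbhd_families FF) (~` dense_open_families X) ->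
  II_mark_wins (open_covers_of FF) (dense_open_families X).
Proof.
move=> /I_pre_wins_open_nbhdP[A FA dA].
have /choice[tau tauP] : forall p : set (set X) * nat, exists U,
    open_covers_of FF p.1 -> p.1 U /\ A p.2 `<=` U.
  move=> [UU n] /=; have [cov|ncov] := pselect (open_covers_of FF UU).
    by case: (cov) => _ _ _ _ /(_ _ (FA n))[U UUU AU]; exists U.
  by exists setT => /ncov.
exists (fun UU n => tau (UU, n)).
  by move=> UU n /(tauP (UU, n))[].
move=> UU UUP; apply: (proj1 (open_nbhds_dense _ FA)) => // n.
have [/= tauUU Atau] := tauP (UU n, n) (UUP n).
have [UUo _ UU0 UUT _] := UUP n.
split=> //; split; first exact: UUo.
  by have [x Ax] := FF_neq0 _ (FA n); exists x; exact: Atau.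
by apply/eqP => tauT; rewrite tauT in tauUU.
Qed.

Lemma II_mark_wins_I_pre_wins :
  II_mark_wins (open_covers_of FF) (dense_open_families X) ->
  I_pre_wins (open_nbhd_families FF) (~` dense_open_families X).
Proof.
move=> [tau tauP win].
have /choice[A AP] : forall n, exists A, FF A /\
    forall U, open_nbhd_family A U ->
      exists2 UU, open_covers_of FF UU & tau UU n = U.
  by move=> n; have [|A FA AU] := @selector_covers_nbhds (tau^~ n);
    [move=> UU; exact: tauP|exists A].
exists (fun n => open_nbhd_family (A n)).
  by move=> n; exists (A n) => //; case: (AP n).
move=> U AU; apply.
have /choice[UU UUP] : forall n, exists UU,
    open_covers_of FF UU /\ tau UU n = U n.
  by move=> n; have [_ /(_ _ (AU n))[UU]] := AP n; exists UU.
have -> : U = fun n => tau (UU n) n.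
  by apply/funext => n; case: (UUP n).
by apply: win => n; case: (UUP n).
Qed.

(** One keeps a shadow play of the game on covers.  At a history s of covers,
[selector_covers_nbhds] gives a set A s all of whose proper open neighborhoods
are answers of tau to a continuation of s; One plays A s and translates the
neighborhood chosen by Two into a cover that makes tau answer it.  Hence Two's
moves are those of a play in which tau is followed. *)
Lemma II_wins_I_wins : FF !=set0 ->
  II_wins (open_covers_of FF) (dense_open_families X) ->
  I_wins (open_nbhd_families FF) (~` dense_open_families X).
Proof.
move=> [A0 FA0] [tau tauP win].
(* A0 and set0 are default values off the legal histories and answers *)
pose legal s := all (fun UU => UU \in open_covers_of FF) s.
have /choice[A AP] : forall s, exists A, FF A /\ (legal s ->
    forall U, open_nbhd_family A U ->
      exists2 UU, open_covers_of FF UU & tau (rcons s UU) = U).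
  move=> s; have [ls|nls] := pselect (legal s); last by exists A0.
  by have [|A FA AU] := @selector_covers_nbhds (fun UU => tau (rcons s UU));
    [move=> UU; exact: tauP|exists A].
have /choice[sel selP] : forall p : seq (set (set X)) * set X, exists UU,
    legal p.1 -> open_nbhd_family (A p.1) p.2 ->
    open_covers_of FF UU /\ tau (rcons p.1 UU) = p.2.
  move=> [s U] /=; have [ls|nls] := pselect (legal s); last by exists set0.
  have [AU|nAU] := pselect (open_nbhd_family (A s) U); last by exists set0.
  by have [_ /(_ ls U AU)[UU]] := AP s; exists UU.
(* the shadow history of covers that explains the moves of Two *)
pose covers := foldl (fun s U => rcons s (sel (s, U))) [::].
exists (fun u => open_nbhd_family (A (covers u))).
  by move=> u _; exists (A (covers u)) => //; case: (AP (covers u)).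
move=> U AU; apply.
pose UU n := sel (covers (mkseq U n), U n).
have coversE n : covers (mkseq U n) = mkseq UU n.
  by elim: n => // n IHn; rewrite !mkseqS -IHn /covers foldl_rcons.
have lUU n : legal (mkseq UU n).
  elim: n => // n IHn; rewrite mkseqS /legal all_rcons andbC.
  apply/andP; split; first exact: IHn.
  have [||UUn _] := selP (covers (mkseq U n), U n).
  - by rewrite coversE.
  - exact: AU.
  - exact: mem_set.
have UUP n : open_covers_of FF (UU n) /\ tau (rcons (mkseq UU n) (UU n)) = U n.
  rewrite -coversE.
  apply: (selP (covers (mkseq U n), U n)); last exact: AU.
  rewrite coversE; exact: lUU.
have -> : U = fun n => tau (mkseq UU n.+1).
  by apply/funext => n; rewrite mkseqS; case: (UUP n).
by apply: win => n; case: (UUP n).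
Qed.

(** The countable tree argument: positions are lists of naturals, the k-th child
of a position being Two's choice of the k-th basic neighborhood of the set that
One has just played.  The countably many sets played at all the positions have a
dense union, for otherwise one branch would defeat One. *)
Lemma I_wins_countably_densely_covered :
  (forall A, FF A -> countable_outer_base A) ->
  I_wins (open_nbhd_families FF) (~` dense_open_families X) ->
  countably_densely_covered FF.
Proof.
move=> FFbase [sigma sigmaP win].
have [A0 FA0 _] := sigmaP [::] isT.
have /choice[A AP] : forall s, exists A, FF A /\
    (all (fun U => U \in \bigcup_(N in open_nbhd_families FF) N) s ->
     sigma s = open_nbhd_family A).
  move=> s; have [ls|nls] := pselect
      (all (fun U => U \in \bigcup_(N in open_nbhd_families FF) N) s).
    by have [A FA <-] := sigmaP s ls; exists A.
  by exists A0; split=> // /nls.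
have FA s : FF (A s) by case: (AP s).
have /choice[b bP] : forall s, exists b : nat -> set X,
    (forall k, open (b k) /\ A s `<=` b k) /\
    forall O, open O -> A s `<=` O -> exists k, b k `<=` O.
  by move=> s; have [b] := FFbase _ (FA s); exists b.
(* Some lists lead to positions that are not legal, since a basic neighborhood
   may be the whole space; there A takes the value A0. *)
pose hist := foldl (fun s k => rcons s (b s k)) [::].
exists (fun n => A (hist (odflt [::] (unpickle n)))) => //.
apply: contrapT => /(regular_not_dense X_regular)[V [oV V0 AV]].
have ocV : open (~` closure V) by rewrite openC; exact: closed_closure.
have /choice[k kP] : forall l, exists k, b (hist l) k `<=` ~` closure V.
  move=> l; have [_] := bP (hist l); apply=> // x Ax; apply: AV.
  by exists (pickle l) => //; rewrite pickleK.
(* the branch along which Two avoids the closure of V at every step *)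
pose branch := fix branch n :=
  if n is m.+1 then rcons (branch m) (k (branch m)) else [::].
pose U n := b (hist (branch n)) (k (branch n)).
have histE n : mkseq U n = hist (branch n).
  by elim: n => // n IHn; rewrite mkseqS IHn /= /hist foldl_rcons.
have UN n : open_nbhd_family (A (hist (branch n))) (U n).
  have [/(_ (k (branch n)))[oU AU] _] := bP (hist (branch n)).
  split=> //; split=> //.
    by have [x Ax] := FF_neq0 _ (FA (hist (branch n))); exists x; exact: AU.
  apply/eqP => UT; have [x Vx] := V0.
  by apply: (kP (branch n) x); [rewrite -/(U n) UT|exact: subset_closure].
apply: (win U) => [n|].
  rewrite histE; have [_ ->] := AP (hist (branch n)); first exact: UN.
  rewrite -histE; apply/allP => W /mapP[i _ ->]; apply: mem_set.
  exists (open_nbhd_family (A (hist (branch i)))); last exact: UN.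
  by exists (A (hist (branch i))).
move=> [_ /dense_closureP/(_ V V0 oV)[x [Vx [_ [n _ <-] Ux]]]].
by apply: (kP (branch n) x Ux); exact: subset_closure.
Qed.

End GamesOnCoverings.

(** * Compact subsets of metrizable spaces *)

Section MetrizableSpaces.
Local Open Scope ring_scope.
Import Order.TTheory GRing.Theory Num.Theory.

(** The neighborhood of radius 1/(k+1) of A is the union of the balls of that
radius around the points of A.  That some k puts it inside a given open O is
the Lebesgue number lemma, obtained from the covering form of compactness for
properties that hold near each point and for all large k. *)
Lemma metrizable_compact_outer_base {R : realType} {X : topologicalType} :
  metrizable X R -> forall A : set X, compact A -> countable_outer_base A.
Proof.
move=> [d [d0 _ dC dD nbhsd]] A cA.
have nbhs_ball x (e : R) : 0 < e -> nbhs x [set y | d x y < e].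
  by move=> e0; rewrite nbhsd; exists e.
have open_ball x (e : R) : open [set y | d x y < e].
  rewrite openE => y /= xy; rewrite /interior nbhsd.
  exists (e - d x y); rewrite /= ?subr_gt0 // => z /= yz.
  by rewrite (le_lt_trans (dD y x z)) // addrC -ltrBrDr.
exists (fun k => \bigcup_(x in A) [set y | d x y < k.+1%:R^-1]).
  move=> k; split; first by apply: bigcup_open => x _; exact: open_ball.
  by move=> x Ax; exists x => //=; rewrite d0 invr_gt0.
move=> O oO AO.
have /compact_near_coveringP/(_ nat \oo
    (fun k x => [set y | d x y < k.+1%:R^-1] `<=` O)) := cA.
case=> [x Ax|k _ kP]; last first.
  by exists k => y [x Ax /=]; exact: (kP k (leqnn k) x Ax).
have : nbhs x O by exact: open_nbhs_nbhs (conj oO (AO x Ax)).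
rewrite {1}nbhsd => -[e /= e0 eO].
(* half of e for the move from x to x', half for the radius of the ball *)
have e2 : 0 < e / 2 by rewrite divr_gt0.
near=> x' k => y /= x'y; apply: eO => /=.
rewrite (le_lt_trans (dD x' x y)) // (splitr e) ltrD //.
  by near: x'; exact: nbhs_ball.
apply: lt_trans x'y _; near: k; exact: near_infty_natSinv_lt (PosNum e2).
Unshelve. all: by end_near. Qed.

End MetrizableSpaces.

(** * The equivalences *)

Theorem corollary55 (R : realType) (X : topologicalType)
    (X_regular : regular_space X) (X_T1 : accessible_space X) :
  [/\ infinite_set [set: X] ->
        [<-> separable X;
             I_pre_wins (open_nbhd_families (nonempty_finites X))
               (~` dense_open_families X);
             II_mark_wins (omega_covers X) (dense_open_families X)],
      ~ compact [set: X] ->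
        [<-> wkc_le (nonempty_compacts X) [set: nat];
             I_pre_wins (open_nbhd_families (nonempty_compacts X))
               (~` dense_open_families X);
             II_mark_wins (k_covers X) (dense_open_families X)] &
      metrizable X R ->
        (infinite_set [set: X] ->
           [<-> separable X;
                I_pre_wins (open_nbhd_families (nonempty_finites X))
                  (~` dense_open_families X);
                I_wins (open_nbhd_families (nonempty_finites X))
                  (~` dense_open_families X);
                II_mark_wins (omega_covers X) (dense_open_families X);
                II_wins (omega_covers X) (dense_open_families X)]) /\
        (~ compact [set: X] ->
           [<-> wkc_le (nonempty_compacts X) [set: nat];
                I_pre_wins (open_nbhd_families (nonempty_compacts X))
                  (~` dense_open_families X);
                I_wins (open_nbhd_families (nonempty_compacts X))
                  (~` dense_open_families X);
                II_mark_wins (k_covers X) (dense_open_families X);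
                II_wins (k_covers X) (dense_open_families X)])].
Proof.
have fin_neq0 A : nonempty_finites X A -> A !=set0 by case.
have fin_pt x : nonempty_finites X [set x].
  by split; [exact: finite_set1|exists x].
have cpt_neq0 A : nonempty_compacts X A -> A !=set0 by case.
have cpt_pt x : nonempty_compacts X [set x].
  by split; [exact: finite_compact (finite_set1 x)|exists x].
have infX0 : infinite_set [set: X] -> [set: X] !=set0.
  exact: infinite_setN0.
have ncptX0 : ~ compact [set: X] -> [set: X] !=set0.
  move=> ncX; apply/set0P/eqP => X0; apply: ncX; rewrite X0.
  exact: compact0.
have base := @metrizable_compact_outer_base R X.
split=> [/infX0 X0|/ncptX0 X0|mX]; last split=> [/infX0 X0|/ncptX0 X0].
- tfae.
  + by move=> /(separableP X0)/(I_pre_wins_open_nbhdP _ fin_neq0 X_regular).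
  + exact: I_pre_wins_II_mark_wins.
  + move=> /(II_mark_wins_I_pre_wins _ fin_pt).
    by move=> /(I_pre_wins_open_nbhdP _ fin_neq0 X_regular)/(separableP X0).
- tfae.
  + by move=> /(wkc_le_natP _ X0)/(I_pre_wins_open_nbhdP _ cpt_neq0 X_regular).
  + exact: I_pre_wins_II_mark_wins.
  + move=> /(II_mark_wins_I_pre_wins _ cpt_pt).
    by move=> /(I_pre_wins_open_nbhdP _ cpt_neq0 X_regular)/(wkc_le_natP _ X0).
- have [x _] := X0.
  have Icov := I_wins_countably_densely_covered _ fin_neq0 X_regular
    (fun A FA => base mX A (finite_compact (proj1 FA))).
  tfae.
  + by move=> /(separableP X0)/(I_pre_wins_open_nbhdP _ fin_neq0 X_regular).
  + exact: I_pre_wins_I_wins.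
  + move=> /Icov/(I_pre_wins_open_nbhdP _ fin_neq0 X_regular).
    exact: I_pre_wins_II_mark_wins.
  + exact: II_mark_wins_II_wins.
  + move=> /(II_wins_I_wins _ fin_pt (ex_intro _ _ (fin_pt x)))/Icov.
    by move=> /(separableP X0).
- have [x _] := X0.
  have Icov := I_wins_countably_densely_covered _ cpt_neq0 X_regular
    (fun A FA => base mX A (proj1 FA)).
  tfae.
  + by move=> /(wkc_le_natP _ X0)/(I_pre_wins_open_nbhdP _ cpt_neq0 X_regular).
  + exact: I_pre_wins_I_wins.
  + move=> /Icov/(I_pre_wins_open_nbhdP _ cpt_neq0 X_regular).
    exact: I_pre_wins_II_mark_wins.
  + exact: II_mark_wins_II_wins.
  + move=> /(II_wins_I_wins _ cpt_pt (ex_intro _ _ (cpt_pt x)))/Icov.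
    by move=> /(wkc_le_natP _ X0).
Qed.
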